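(* Let $D$ be a connected diagram of the (oriented, classical) link $L$, and let $\mathbb{D}$ be the all-$A$ ribbon graph of $D$. The Jones polynomial of $L$ evaluated at $q^2$ can be expressed as $$J_L(q^2)=\sum_{\mathbb{T}\in\mathcal{Q}(\mathbb{D})}(-1)^{i(\mathbb{T})-n_-}q^{\,j(\mathbb{T})+n_+-2n_-},$$ where $\mathcal{Q}(\mathbb{D})$ is the set of spanning quasi-trees of $\mathbb{D}$ and $n_+$, $n_-$ are the numbers of positive and negative crossings in $D$ respectively.
   Context: **Ribbon graphs.** A ribbon graph $\mathbb{G}$ (always oriented) is a finite nonempty graph (loops and multiple edges allowed) together with an embedding into a closed oriented surface whose complement is a disjoint union of open disks; equivalently, a graph with a cyclic order of the half-edges at each vertex. $\Sigma_{\mathbb{G}}$ is a regular neighborhood of $\mathbb{G}$ in the surface: one disk per vertex, one band per edge. A spanning ribbon subgraph has the same vertices, a subset of the edges, and inherited cyclic orders. A spanning quasi-tree $\mathbb{T}$ is a spanning ribbon subgraph such that $\Sigma_{\mathbb{T}}$ has exactly one boundary component; $g(\mathbb{T})$ is the genus of $\Sigma_{\mathbb{T}}$ with its boundary capped by a disk. **All-$A$ ribbon graph.** At a crossing whose over-strand runs from SW to NE and under-strand from SE to NW, the $A$-resolution consists of two arcs joining SW to NW and NE to SE. Resolving every crossing of $D$ by $A$ gives disjoint circles. At each crossing $x$ place one arrow labeled $x$ on each of the two arcs of the resolution, both directed from the over-strand end to the under-strand end. $\Sigma_{\mathbb{D}}$ is obtained by taking an abstract disk (vertex) bounded by each circle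 and, for each $x$, gluing a band (edge) along two opposite sides to the two arrows labeled $x$ so that the arrow directions agree with one orientation of the boundary of the band. For classical $D$ the result is orientable, giving $\mathbb{D}$. **Activities and gradings.** Label the edges of $\mathbb{D}$ (in any order) $e_1,\dots,e_n$, with $e_i<e_j$ iff $i<j$. For a spanning quasi-tree $\mathbb{T}$, mark $2n$ points on the boundary circle of $\Sigma_{\mathbb{T}}$: for $e_i\in E(\mathbb{T})$, one point labeled $i$ on each of the two free sides of its band; for $e_i\notin E(\mathbb{T})$, one point labeled $i$ at each of the two places on the vertex-disk boundaries where the band of $e_i$ would be attached. Join the two points labeled $i$ by a chord $c_i$. The edge $e_i$ is internal if $e_i\in E(\mathbb{T})$, external otherwise; it is active if $c_i$ does not intersect any $c_j$ with $j<i$. $ia(\mathbb{T})$, $ea(\mathbb{T})$ are the numbers of internally active and externally active edges. Set $$i(\mathbb{T})=2g(\mathbb{T})+ea(\mathbb{T})-ia(\mathbb{T})+|V(\mathbb{D})|-1,\qquad j(\mathbb{T})=2(g(\mathbb{T})+ea(\mathbb{T})-ia(\mathbb{T}))+|V(\mathbb{D})|-1,$$ where $V(\mathbb{D})$ is the vertex set. **Jones polynomial.** $J_L(t)$ is normalized to be $1$ on the unknot; its evaluation at $t=q^2$ is taken with $t^{1/2}=-q$, so that $J_L(q^2)$ is the graded Euler characteristic of reduced Khovanov homology and satisfies $q^{-2}J_{L_+}(q^2)-q^{2}J_{L_-}(q^2)=(q^{-1}-q)J_{L_0}(q^2)$. *)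

(* Defs.v *)
From HB Require Import structures.
From mathcomp Require Import all_boot all_order all_fingroup all_algebra.
From mathcomp Require Import zify.

Set Implicit Arguments.
Unset Strict Implicit.
Unset Printing Implicit Defensive.

Import Order.TTheory GRing.Theory Num.Theory.
Local Open Scope ring_scope.

(** * Oriented link diagrams *)

(* The four ends of strand at a crossing, which is drawn so that the over-strand
   runs from SW to NE and the under-strand from SE to NW.  The picture is only
   determined up to a half-turn; nothing below depends on that choice. *)
Inductive corner := SW | SE | NE | NW.

Definition corner_code (k : corner) : 'I_4 :=
  match k with SW => inord 0 | SE => inord 1 | NE => inord 2 | NW => inord 3 end.

Definition corner_decode (i : 'I_4) : corner :=
  match val i with 0%N => SW | 1%N => SE | 2%N => NE | _ => NW end.

Lemma corner_codeK : cancel corner_code corner_decode.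
Proof. by case; rewrite /corner_decode /= inordK. Qed.

HB.instance Definition _ := Finite.copy corner (can_type corner_codeK).

Definition ccw (k : corner) : corner :=
  match k with SW => SE | SE => NE | NE => NW | NW => SW end.

Definition opposite (k : corner) : corner := ccw (ccw k).

Definition resolveA (k : corner) : corner :=
  match k with SW => NW | NW => SW | NE => SE | SE => NE end.

Definition resolveB (k : corner) : corner :=
  match k with SW => SE | SE => SW | NE => NW | NW => NE end.

Section FourValentMap.

Variables (X : finType) (arc : X * corner -> X * corner).

Definition map_components : nat :=
  n_comp [rel u v | (v == arc u) || (u.1 == v.1)] predT.

Definition map_faces : nat :=
  fcard (fun u => let v := arc u in (v.1, ccw v.2)) predT.

End FourValentMap.

(* A diagram is recorded as a 4-valent combinatorial map: [arc] matches the two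
   ends of each arc of the diagram, and [loops] is the number of components of
   the diagram without crossings.  [outgoing u] says that, following the
   orientation of the link, one leaves the crossing [u.1] at the end [u]; by
   [outgoing_arc] the involution [arc] has no fixed point.  (The orientation of
   crossingless components is not recorded: it affects neither the signs of
   crossings nor the resolutions.)
   With #|X| vertices and 2 * #|X| edges, [diagram_planar] is Euler's formula
   V - E + F = 2k summed over the k connected components of the map, all of
   which then have genus 0. *)
Record link_diagram := LinkDiagram {
  crossing : finType;
  loops : nat;
  arc : crossing * corner -> crossing * corner;
  outgoing : crossing * corner -> bool;
  arcK : involutive arc;
  outgoing_arc : forall u, outgoing (arc u) = ~~ outgoing u;
  outgoing_opposite : forall x k, outgoing (x, opposite k) = ~~ outgoing (x, k);
  diagram_planar :
    map_faces arc = (#|crossing| + (map_components arc).*2)%N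
}.

Definition connected_diagram (D : link_diagram) : Prop :=
  (map_components (@arc D) + loops D = 1)%N.

(* Both strands run upwards or both downwards, the over-strand from SW to NE. *)
Definition positive (D : link_diagram) (x : crossing D) : bool :=
  outgoing (x, NE) == outgoing (x, NW).

Definition n_plus (D : link_diagram) : nat := #|[set x : crossing D | positive x]|.
Definition n_minus (D : link_diagram) : nat := #|[set x : crossing D | ~~ positive x]|.
Definition writhe (D : link_diagram) : int := (n_plus D)%:Z - (n_minus D)%:Z.

(** * The Jones polynomial *)

(* A state is given by the set S of crossings that are resolved by B. *)
Definition smoothing (D : link_diagram) (S : {set crossing D})
    (u : crossing D * corner) : crossing D * corner :=
  (u.1, if u.1 \in S then resolveB u.2 else resolveA u.2).

Definition state_circles (D : link_diagram) (S : {set crossing D}) : nat :=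
  (n_comp [rel u v | (v == arc u) || (v == smoothing S u)]
          predT + loops D)%N.

(* Kauffman's bracket, with value 1 on one circle. *)
Definition bracket (D : link_diagram) (R : comUnitRingType) (A : R) : R :=
  \sum_(S : {set crossing D})
    A ^ (#|~: S|%:Z - #|S|%:Z) * (- A ^+ 2 - A ^- 2) ^+ (state_circles S).-1.

(* [jones D s] is J_L(t) at t^(1/2) = s, for L the link with diagram D: it is
   Kauffman's (- A^3)^(- writhe) <D> at A^(-2) = t^(1/2), rewritten in terms of
   A^(-2), which is all it depends on; see [jones_bracket].  A Laurent polynomial
   in t^(1/2) is treated as a function of a unit s of an arbitrary commutative
   ring; the indeterminate of a ring of Laurent polynomials is one such s. *)
Definition jones (D : link_diagram) (R : comUnitRingType) (s : R) : R :=
  (- 1) ^ writhe D *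
  \sum_(S : {set crossing D})
    s ^ ((n_plus D)%:Z - 2 * (n_minus D)%:Z + #|S|%:Z)
    * (- s - s^-1) ^+ (state_circles S).-1.

Lemma crossings_signs (D : link_diagram) :
  #|crossing D| = (n_plus D + n_minus D)%N.
Proof.
rewrite /n_plus /n_minus -(cardsC [set x : crossing D | positive x]).
by congr (_ + _)%N; apply: eq_card => x; rewrite !inE.
Qed.

Lemma jones_bracket (D : link_diagram) (R : comUnitRingType) (A : R) :
  A \is a GRing.unit ->
  jones D (A ^- 2) = (- A ^+ 3) ^ (- writhe D) * bracket D A.
Proof.
move=> uA; rewrite /jones /bracket !mulr_sumr; apply: eq_bigr => S _.
have -> : - A ^- 2 - (A ^- 2)^-1 = - A ^+ 2 - A ^- 2 by rewrite invrK addrC.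
rewrite !mulrA; congr (_ * _).
have uN1 : (- 1 : R) \is a GRing.unit by rewrite unitrN1.
have sgnV z : (- 1 : R) ^ (- z) = (- 1) ^ z by rewrite -exprz_inv invrN1.
have -> : - A ^+ 3 = (- 1) * A ^ (3 : int) by rewrite mulN1r.
have -> : A ^- 2 = A ^ (- 2 : int) by rewrite -exprnN.
rewrite exprMz_comm ?unitrXz //; last by apply/commr_sym/commrN1.
rewrite sgnV !exprz_exp -mulrA -exprzDr //; congr (_ * A ^ _).
have := cardsC S; rewrite crossings_signs /writhe; lia.
Qed.

(** * Ribbon graphs *)

(* An oriented ribbon graph with edge set E: each edge e has the half-edges
   (e, false) and (e, true), and [vrot] sends a half-edge to the next one in the
   cyclic order at its vertex.  The vertices are thus the orbits of [vrot],
   together with [isolated] many vertices without half-edges. *)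
Record ribbon_graph (E : finType) := RibbonGraph {
  vrot : {perm E * bool};
  isolated : nat;
  ribbon_nonempty : (0 < fcard vrot predT + isolated)%N
}.

Section RibbonGraph.

Variables (E : finType) (G : ribbon_graph E).

Definition n_vertices : nat := (fcard (vrot G) predT + isolated G)%N.

(* The spanning ribbon subgraph with edge set F.  Run along the boundary of
   Sigma_F in the direction of the boundary of the vertex disks, and consider
   for each half-edge h of G the moment of reaching the place where h is
   attached to its vertex disk.  If the edge of h is not in F one just passes
   this place (the marked point h), and the next one is [vrot G h].  If it is in
   F, one runs along a free side of its band (the marked point h is on that
   side), and arrives on the vertex disk of the other half-edge h' of the same
   edge, just after the place of h'; the next one is [vrot G h']. *)
Definition boundary_next (F : {set E}) (h : E * bool) : E * bool :=
  vrot G (if h.1 \in F then (h.1, ~~ h.2) else h).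

Definition n_boundary (F : {set E}) : nat :=
  (fcard (boundary_next F) predT + isolated G)%N.

Definition quasi_tree (T : {set E}) : bool := n_boundary T == 1%N.

(* Sigma_T is connected, having a single boundary component, and its Euler
   characteristic is |V| - |T|; once capped it is |V| - |T| + 1 = 2 - 2g. *)
Definition genus (T : {set E}) : nat := ((#|T| + 1 - n_vertices)./2)%N.

(* The marked points (e, false) and (e, true) are the ends of the chord of e;
   positions on the boundary circle are counted from (e, false).  Only used for
   e' different from e. *)
Definition chords_cross (T : {set E}) (e e' : E) : bool :=
  let pos h := findex (boundary_next T) (e, false) h in
  (pos (e', false) < pos (e, true))%N != (pos (e', true) < pos (e, true))%N.

Section Activities.

Variable lab : E -> 'I_#|E|.

Definition active (T : {set E}) (e : E) : bool :=
  [forall e' : E, (lab e' < lab e)%N ==> ~~ chords_cross T e e'].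

Definition int_activity (T : {set E}) : nat := #|[set e in T | active T e]|.
Definition ext_activity (T : {set E}) : nat := #|[set e in ~: T | active T e]|.

Definition i_grading (T : {set E}) : int :=
  2 * (genus T)%:Z + (ext_activity T)%:Z - (int_activity T)%:Z
  + n_vertices%:Z - 1.

Definition j_grading (T : {set E}) : int :=
  2 * ((genus T)%:Z + (ext_activity T)%:Z - (int_activity T)%:Z)
  + n_vertices%:Z - 1.

End Activities.

End RibbonGraph.

(** * The all-A ribbon graph *)

(* The arrows, i.e. the half-edges of the all-A ribbon graph: (x, false) is the
   arc from SW to NW at the crossing x, and (x, true) the arc from NE to SE. *)
Definition arrow_tail (b : bool) : corner := if b then NE else SW.
Definition arrow_head (b : bool) : corner := if b then SE else NW.
Definition arrow_at (k : corner) : bool :=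
  match k with NE | SE => true | SW | NW => false end.

Section AllA.

Variable D : link_diagram.

(* [inward u] says that the boundary orientation of the disk bounded by the
   circle through the end [u] runs into the crossing at [u].  The first two
   conditions say that [inward] orients the circles of the all-A state.  The
   third says that at every crossing both arrows agree with the boundary
   orientations of the disks, or both disagree: this is when a band glued along
   the two arrows, as opposite sides with one orientation of its boundary, is
   compatible with the orientations of the disks. *)
Definition disk_orientation (inward : crossing D * corner -> bool) : Prop :=
  [/\ forall u, inward (arc u) = ~~ inward u,
      forall x k, inward (x, resolveA k) = ~~ inward (x, k)
    & forall x, inward (x, arrow_tail false) = inward (x, arrow_tail true)].

(* The end at which the oriented circle leaves the arrow h. *)
Definition arrow_exit (inward : crossing D * corner -> bool)
    (h : crossing D * bool) : crossing D * corner :=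
  (h.1, if inward (h.1, arrow_tail h.2) then arrow_head h.2 else arrow_tail h.2).

Definition next_arrow (inward : crossing D * corner -> bool)
    (h : crossing D * bool) : crossing D * bool :=
  let u := arc (arrow_exit inward h) in (u.1, arrow_at u.2).

(* G is the all-A ribbon graph of D, for one of the orientations of its surface
   (two for a connected diagram with crossings: an [inward] as above alternates
   around each crossing, so it amounts to a checkerboard colouring of the faces
   of D, every arc running with its black face on the left). *)
Definition all_A_ribbon_graph (G : ribbon_graph (crossing D)) : Prop :=
  isolated G = loops D /\
  exists2 inward, disk_orientation inward
                & forall h, vrot G h = next_arrow inward h.

End AllA.

(* Main.v *)
Require Import Defs.
From mathcomp Require Import all_boot all_order all_fingroup all_algebra.
From mathcomp Require Import zify.

Import Order.TTheory GRing.Theory Num.Theory.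

(** Resolving the crossings of S by B and the others by A corresponds, in the
    all-A ribbon graph, to keeping exactly the bands of S: the state circles are
    the boundary components of the spanning ribbon subgraph with edge set S
    ([state_circles_boundary]).  Writing b(F) for the number of boundary
    components of F, the state sum of the diagram is thus, up to a monomial in q,
    the sum over all edge sets F of (-q)^|F| (q + q^-1)^(b(F) - 1), and what is
    left is an expansion of this sum over the quasi-trees of an arbitrary
    connected ribbon graph ([quasi_tree_expansion]).

    Adding or removing a band multiplies the boundary permutation by a
    transposition, so it changes b by one: b goes up if the two marked points of
    the edge lie on one boundary component, and down otherwise
    ([n_boundary_toggle]).  Decide which edges belong to F one at a time, from the
    largest label to the smallest, and follow only the partial decisions that
    some quasi-tree extends.  When both choices for an edge e extend, the sum
    just splits in two.  When only one does, the two marked points of e lie on a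
    common boundary component whatever is decided later ([joined_of_forced]), so
    the other choice always gives one more component and contributes an extra
    factor q + q^-1.  The two halves then add up to one half times
    1 - q (q + q^-1) = - q^2 if the extending choice leaves e out, and times
    - q + (q + q^-1) = (-q) (- q^-2) if it keeps e.

    The decisions that survive to the end are the quasi-trees T, and each factor
    - q^2 or - q^-2 records an edge whose choice was forced.  These edges are the
    active ones: removing or adding e in T cuts the boundary circle along the
    chord of e, and a lower edge can join the two halves again exactly if its
    chord crosses that of e ([chords_crossE], [active_extendable]).  Hence T
    contributes (-q)^|T| (- q^2)^ea (- q^-2)^ia.  Since 2 g(T) = |T| + 1 - |V|,
    the gradings are i(T) = |T| + ea - ia and j(T) = |T| + 2 (ea - ia), and this
    is the term of the stated sum. *)

Set Implicit Arguments.
Unset Strict Implicit.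
Unset Printing Implicit Defensive.

(** * Components of relations *)

(** The representatives of the coarser classes lie in distinct finer classes. *)
Lemma n_comp_mono (T : finType) (e1 e2 : rel T) :
  connect_sym e1 -> connect_sym e2 ->
  (forall x y, connect e1 x y -> connect e2 x y) ->
  n_comp e2 predT <= n_comp e1 predT.
Proof.
move=> sym1 sym2 sub12; rewrite /n_comp_mem.
have inj_r : {in predI (roots e2) predT &, injective (fingraph.root e1)}.
  move=> x y /andP[/eqP rx _] /andP[/eqP ry _] /(fingraph.rootP sym1)/sub12.
  by move/(fingraph.rootP sym2); rewrite rx ry.
rewrite -(card_in_image inj_r); apply/subset_leq_card/subsetP=> _ /imageP[x _ ->].
by rewrite !inE /= (roots_root sym1).
Qed.

Lemma fcard_porbits (T : finType) (s : {perm T}) : fcard s predT = #|porbits s|.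
Proof.
have fconn x y : fconnect s x y = (porbit s x == porbit s y).
  rewrite eq_porbit_mem porbit_sym; apply/idP/porbitP=> [/iter_findex <-|[i ->]].
    by exists (findex s x y); rewrite permX.
  by rewrite permX fconnect_iter.
have symS : connect_sym (frel s) by move=> x y; rewrite !fconn eq_sym.
have inj_r : {in predI (froots s) predT &, injective (porbit s)}.
  move=> x y /andP[/eqP rx _] /andP[/eqP ry _] /eqP; rewrite -fconn.
  by move/(fingraph.rootP symS); rewrite rx ry.
rewrite /n_comp_mem -(card_in_image inj_r); apply: eq_card => A.
apply/imageP/imsetP=> [[x _ ->]|[x _ ->]]; first by exists x.
exists (fingraph.root (frel s) x); first by rewrite !inE /= (roots_root symS).
by apply/eqP; rewrite -fconn connect_root.
Qed.

(** * Boundary components of spanning ribbon subgraphs *)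

Section Ribbon.

Variables (E : finType) (G : ribbon_graph E).
Implicit Types (F T L : {set E}) (e f : E) (h : E * bool).

Definition flip h : E * bool := (h.1, ~~ h.2).

Definition toggle e F : {set E} := [set f | (f \in F) (+) (f == e)].

Lemma toggleK e : involutive (toggle e).
Proof. by move=> F; apply/setP=> f; rewrite !inE -addbA addbb addbF. Qed.

Lemma toggle_id e F : (e \in toggle e F) = (e \notin F).
Proof. by rewrite inE eqxx addbT. Qed.

Lemma boundary_next_inj F : injective (boundary_next G F).
Proof.
apply: (inj_comp (@perm_inj _ (vrot G)) (inv_inj _)) => -[e b].
by rewrite /=; case eF: (e \in F); rewrite /= eF ?negbK.
Qed.

Lemma boundary_sym F : connect_sym (frel (boundary_next G F)).
Proof. exact: fconnect_sym (@boundary_next_inj F). Qed.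

Definition joined F e : bool := fconnect (boundary_next G F) (e, false) (e, true).

Lemma joined_ends F e b c :
  joined F e -> fconnect (boundary_next G F) (e, b) (e, c).
Proof.
move=> Je; case: b c => [] []; [exact: connect0| |exact: Je|exact: connect0].
by rewrite boundary_sym.
Qed.

(** Taking a band in or out precomposes the boundary permutation with the
    exchange of the two half-edges of its edge. *)
Lemma boundary_next_toggle F e h :
  boundary_next G (toggle e F) h =
  boundary_next G F (if h.1 == e then flip h else h).
Proof.
case: h => a b; rewrite /boundary_next /flip inE /=.
case: (a == e) => /=; last by rewrite addbF.
by rewrite addbT; case: (a \in F); rewrite /= ?negbK.
Qed.

(** Multiplication by a transposition splits a cycle that contains both of the
    exchanged points and merges two cycles otherwise. *)
Lemma n_boundary_toggle F e :
  n_boundary G (toggle e F) + (~~ joined F e).*2 = (n_boundary G F).+1.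
Proof.
pose s A := perm (@boundary_next_inj A).
have cardS A : fcard (boundary_next G A) predT = #|porbits (s A)|.
  by rewrite -fcard_porbits; apply: eq_fcard => h; rewrite permE.
have sE : s (toggle e F) = (tperm (e, true) (e, false) * s F)%g.
  apply/permP=> h; rewrite permM [LHS]permE [RHS]permE boundary_next_toggle; congr (boundary_next _ _).
  case: h => a b /=; rewrite /flip /=; case: eqP => [->|/eqP ne_a].
    by case: b; rewrite ?tpermL ?tpermR.
  by rewrite tpermD // xpair_eqE eq_sym (negPf ne_a).
have := porbits_mul_tperm (s F) (e, true) (e, false); rewrite /= -sE /n_boundary !cardS.
have -> : ((e, true) \in porbit (s F) (e, false)) = joined F e.
  rewrite /joined (eq_fconnect (f' := s F)) => [|h]; last by rewrite permE.
  apply/porbitP/idP=> [[i ->]|/iter_findex <-]; first by rewrite permX fconnect_iter.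
  by exists (findex (s F) (e, false) (e, true)); rewrite permX.
by rewrite xpair_eqE andbF /=; lia.
Qed.

Lemma joined_toggle F e : joined F e || joined (toggle e F) e.
Proof.
have := n_boundary_toggle F e; have := n_boundary_toggle (toggle e F) e.
by rewrite toggleK; case: (joined F e); case: (joined _ e) => //=; lia.
Qed.

Lemma n_boundary_gt0 F : 0 < n_boundary G F.
Proof.
have := ribbon_nonempty G; rewrite /n_boundary; case: (isolated G) => [|n]; last lia.
have fcardP (p : E * bool -> E * bool) :
    injective p -> reflect (exists h : E * bool, True) (0 < fcard p predT).
  move=> inj_p; apply: (iffP card_gt0P) => -[h _]; first by exists h.
  by exists (froot p h); rewrite inE /= roots_root //; exact: fconnect_sym.
rewrite !addn0 => /(fcardP _ (@perm_inj _ _)) exh.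
by apply/fcardP => //; exact: boundary_next_inj.
Qed.

(** The hypothesis makes every boundary component of [F'] part of one of [F]. *)
Lemma leq_n_boundary F F' :
  (forall h, fconnect (boundary_next G F) h (boundary_next G F' h)) ->
  n_boundary G F <= n_boundary G F'.
Proof.
move=> sub; rewrite leq_add2r; apply: n_comp_mono; try exact: boundary_sym.
by apply: connect_sub => h _ /eqP <-.
Qed.

(** The edges of L are those still undecided: [F] and [F'] agree when they come
    from the same decisions on all other edges. *)
Definition agree L F F' : bool := F' :\: L == F :\: L.

Lemma agreeP L F F' :
  reflect (forall e, e \notin L -> (e \in F') = (e \in F)) (agree L F F').
Proof.
apply: (iffP eqP) => [/setP eqF e Le | eqF].
  by have := eqF e; rewrite !inE Le.
by apply/setP=> e; rewrite !inE; case: (boolP (e \in L)) => //= /eqF.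
Qed.

Lemma agree_refl L F : agree L F F. Proof. exact: eqxx. Qed.

Lemma agree_sym L F F' : agree L F F' = agree L F' F.
Proof. exact: eq_sym. Qed.

Lemma agree_eql L F F' : agree L F F' -> agree L F =1 agree L F'.
Proof. by move=> /eqP eqF F1; rewrite /agree eqF. Qed.

Lemma agree_toggle L F F' e :
  agree L (toggle e F) (toggle e F') = agree L F F'.
Proof.
apply/agreeP/agreeP=> eqF f /eqF; rewrite !inE; last by move->.
by move/(can_inj (addbK _)).
Qed.

Lemma agree_toggle_in L F e : e \in L -> agree L F (toggle e F).
Proof.
by move=> Le; apply/agreeP=> f; rewrite inE; case: eqP => [->|]; rewrite ?Le ?addbF.
Qed.

Lemma agreeU1 L F F' e : e \notin L ->
  agree (e |: L) F F' = agree L F F' (+) agree L (toggle e F) F'.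
Proof.
move=> Le.
have agreeE F1 : agree L F1 F' = agree (e |: L) F1 F' && ((e \in F') == (e \in F1)).
  apply/agreeP/andP=> [eqF|[/agreeP eqF /eqP eqe] f Lf].
    by split; [apply/agreeP=> f; rewrite !inE negb_or => /andP[_ /eqF] | rewrite eqF].
  by have [->//|ne_f] := eqVneq f e; apply: eqF; rewrite !inE negb_or ne_f.
have eU : e \in e |: L by rewrite !inE eqxx.
rewrite !agreeE toggle_id -(agree_eql (agree_toggle_in F eU)).
by case: (agree _ _ _); case: (e \in F'); case: (e \in F).
Qed.

Lemma agree_disjoint L F F' e : e \notin L ->
  agree L F F' -> agree L (toggle e F) F' = false.
Proof.
move=> Le /agreeP/(_ e Le) eqe; apply/negP=> /agreeP/(_ e Le).
by rewrite toggle_id eqe; case: (e \in F).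
Qed.

(** * Partial resolutions that extend to a quasi-tree *)

Definition extendable L F : bool :=
  [exists T : {set E}, agree L F T && quasi_tree G T].

Lemma extendableP L F :
  reflect (exists2 T, agree L F T & quasi_tree G T) (extendable L F).
Proof.
apply: (iffP existsP) => [[T /andP[aT qT]]|[T aT qT]]; exists T => //.
by rewrite aT.
Qed.

Lemma eq_extendable L F F' : agree L F F' -> extendable L F = extendable L F'.
Proof. by move=> /agree_eql eqL; apply: eq_existsb => T; rewrite eqL. Qed.

(** Each such toggle merges two boundary components, so that repeating it leads
    to a single one; [P] is what must be kept true on the way. *)
Lemma extendable_descent L (P : {set E} -> Prop) :
    (forall F, P F -> ~~ quasi_tree G F ->
       exists2 f, f \in L & ~~ joined F f /\ P (toggle f F)) ->
  forall F, P F -> extendable L F.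
Proof.
move=> stepP F; have [n] := ubnP (n_boundary G F).
elim: n F => // n IHn F ltFn PF; have [qF|nqF] := boolP (quasi_tree G F).
  by apply/extendableP; exists F => //; exact: agree_refl.
have [f Lf [nJ Pf]] := stepP F PF nqF.
rewrite (eq_extendable (agree_toggle_in F Lf)); apply: IHn Pf.
by have := n_boundary_toggle F f; rewrite nJ /=; lia.
Qed.

(** The boundary permutations of [F] and [F'] differ by exchanges of half-edges
    of edges in [L], and those stay within one component of [F]. *)
Lemma joined_boundary_next F F' L h :
    (forall f, f \in L -> joined F f) -> agree L F F' ->
  fconnect (boundary_next G F) h (boundary_next G F' h).
Proof.
move=> JL /agreeP eqF; case: h => f b; rewrite [boundary_next G F' _]/boundary_next /=.
have step c : fconnect (boundary_next G F) (f, c)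
    (vrot G (if f \in F then (f, ~~ c) else (f, c))) by exact: fconnect1.
have [Lf|/eqF ->] := boolP (f \in L); last exact: step.
have steps c d : fconnect (boundary_next G F) (f, c) (vrot G (f, d)).
  have [fF|fF] := boolP (f \in F).
    apply: connect_trans (joined_ends c (~~ d) (JL f Lf)) _.
    by have := step (~~ d); rewrite fF negbK.
  apply: connect_trans (joined_ends c d (JL f Lf)) _.
  by have := step d; rewrite (negPf fF).
by case: ifP => _; apply: steps.
Qed.

Lemma all_joined_quasi_tree L F :
  extendable L F -> (forall f, f \in L -> joined F f) -> quasi_tree G F.
Proof.
case/extendableP=> T aT /eqP qT JL; rewrite /quasi_tree eqn_leq n_boundary_gt0 andbT -qT.
by apply: leq_n_boundary => h; apply: joined_boundary_next JL aT.
Qed.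

(** Toggling [e] merges components here, so it separates no two marked points. *)
Lemma joined_merge F e f : ~~ joined F e -> joined F f -> joined (toggle e F) f.
Proof.
move=> nJe; apply: (connect_sub _) => h _ /eqP <-.
apply: (@joined_boundary_next _ _ [set e]); last first.
  by rewrite agree_sym agree_toggle_in // inE.
move=> _ /set1P ->; by have := joined_toggle F e; rewrite (negPf nJe).
Qed.

(** If the marked points of [e] were on two components of some [F'], they would
    be on a single one of [toggle e F'].  From there a quasi-tree could be reached
    without touching [e] again: as [F] extends, some undecided edge joins two
    components as long as there are two, and it is never [e], whose marked points
    stay together under merging. *)
Lemma joined_of_forced L F e :
    extendable (e |: L) F -> ~~ extendable L (toggle e F) ->
  forall F', agree L F F' -> joined F' e.
Proof.
move=> extF nextF F' aF'; apply: contraNT nextF => nJe.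
rewrite (eq_extendable (F' := toggle e F')); last by rewrite agree_toggle.
have eU : e \in e |: L by rewrite !inE eqxx.
have extU A : agree L (toggle e F') A -> extendable (e |: L) A.
  move=> aA; rewrite -(@eq_extendable _ F) // (agree_eql (agree_toggle_in F eU)).
  apply/agreeP=> f; rewrite in_setU1 negb_or => /andP[_ Lf].
  by rewrite (agreeP _ _ _ aA f Lf) !inE (agreeP _ _ _ aF' f Lf).
apply: (@extendable_descent _ (fun A => agree L (toggle e F') A /\ joined A e)).
  move=> A [aA Je] nqA; have extA := extU A aA.
  have /exists_inP[f Uf nJf] : [exists f in e |: L, ~~ joined A f].
    apply: contraNT nqA => /exists_inPn nex; apply: (all_joined_quasi_tree extA).
    by move=> f /nex; rewrite negbK.
  have Lf : f \in L by move: Uf nJf; rewrite !inE => /predU1P[->|//]; rewrite Je.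
  exists f => //; split=> //; split; last exact: joined_merge.
  by rewrite (agree_eql aA) agree_toggle_in.
split; first exact: agree_refl.
by have := joined_toggle F' e; rewrite (negPf nJe).
Qed.

(** Connectedness of the underlying graph: an isolated vertex counts as a
    component of its own. *)
Definition ribbon_connected : Prop :=
  n_comp [rel h h' | (h' == vrot G h) || (h.1 == h'.1)] predT + isolated G = 1.

Lemma ribbon_sym :
  connect_sym [rel h h' | (h' == vrot G h) || (h.1 == h'.1)].
Proof.
have sym2 : connect_sym [rel h h' : E * bool | h.1 == h'.1].
  by apply: sym_connect_sym => h h' /=; rewrite eq_sym.
have eqU : [rel h h' | (h' == vrot G h) || (h.1 == h'.1)]
       =2 relU (frel (vrot G)) [rel h h' | h.1 == h'.1].
  by move=> h h' /=; rewrite [in LHS]eq_sym.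
move=> h h'; rewrite !(eq_connect eqU).
exact: (relU_sym (fconnect_sym (@perm_inj _ _)) sym2).
Qed.

(** Along a subgraph whose bands all return to one boundary component, every
    step of the underlying graph stays in that component; so by connectedness it
    has no other, and a subgraph with more can be improved by a toggle. *)
Lemma connected_extendable F : ribbon_connected -> extendable [set: E] F.
Proof.
move=> connG; apply: (@extendable_descent _ (fun=> True)) => // A _ nqA.
have /existsP[f nJf] : [exists f, ~~ joined A f].
  apply: contraNT nqA => /existsPn nJ.
  have JA f : joined A f by rewrite -[joined A f]negbK.
  rewrite /quasi_tree eqn_leq n_boundary_gt0 andbT -connG leq_add2r.
  apply: n_comp_mono; [exact: ribbon_sym|exact: boundary_sym|].
  apply: connect_sub => h h' /= /orP[/eqP->|/eqP eqh].
    rewrite -[X in connect _ _ X]/(vrot G h).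
    have -> : vrot G h = boundary_next G set0 h by rewrite /boundary_next in_set0.
    apply: (@joined_boundary_next _ _ setT) => //.
    by apply/agreeP=> f; rewrite in_setT.
  by case: h h' eqh => [f b] [g c] /= <-; exact: joined_ends.
exists f => //; split=> //.
Qed.

Lemma n_boundary0 : n_boundary G set0 = n_vertices G.
Proof. by congr (_ + _); apply: eq_fcard => h; rewrite /boundary_next in_set0. Qed.

(** Built up from the bare vertex disks, the number of boundary components
    changes by one with each band. *)
Lemma n_boundary_parity F :
  ~~ odd (n_boundary G F + #|F| + n_vertices G) /\
  n_vertices G <= n_boundary G F + #|F|.
Proof.
have [n] := ubnP #|F|; elim: n F => // n IHn F ltFn.
have [->|[e eF]] := set_0Vmem F.
  by rewrite cards0 addn0 n_boundary0 addnn odd_double.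
have cF : #|toggle e F|.+1 = #|F|.
  rewrite (cardsD1 e F) eF; congr _.+1; apply: eq_card => f; rewrite !inE.
  by case: eqP => [->|_]; rewrite ?eF ?addbF.
have [] := IHn (toggle e F) ltac:(lia).
by have := n_boundary_toggle F e; case: joined => /=; lia.
Qed.

(** Euler's formula.  The parity and the bound above ensure that the truncated
    subtraction and the halving in [genus] lose nothing. *)
Lemma genus_quasi_tree T : quasi_tree G T ->
  ((genus G T).*2 + n_vertices G = #|T| + 1)%N.
Proof.
move=> /eqP qT; have [] := n_boundary_parity T; rewrite qT /genus; lia.
Qed.

(** * Chords of a quasi-tree *)

Lemma quasi_tree_fconnect T h h' :
  quasi_tree G T -> fconnect (boundary_next G T) h h'.
Proof.
move=> /eqP qT; apply/(fingraph.rootP (@boundary_sym T)).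
have /card_le1_eqP : fcard (boundary_next G T) predT <= 1.
  by rewrite -qT leq_addr.
by apply; rewrite !inE /= roots_root //; exact: boundary_sym.
Qed.

Lemma n_boundary_quasi_tree_toggle T e :
  quasi_tree G T -> n_boundary G (toggle e T) = 2 /\ ~~ joined (toggle e T) e.
Proof.
move=> qT; have JT : joined T e by exact: quasi_tree_fconnect.
have := n_boundary_toggle T e; rewrite JT (eqP qT) addn0 => b2; split=> //.
have := n_boundary_toggle (toggle e T) e; rewrite toggleK (eqP qT) b2.
by case: joined => //=; lia.
Qed.

(** Toggling [e] cuts the boundary circle of [T] at the two ends of the chord of
    [e]: the two arcs become the two boundary components, and a chord crosses that
    of [e] exactly if its ends lie on different arcs. *)
Lemma chords_crossE T e e' : quasi_tree G T -> e' != e ->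
  chords_cross G T e e' = ~~ joined (toggle e T) e'.
Proof.
move=> qT ne_e'; rewrite /chords_cross /=.
set next := boundary_next G T; set next' := boundary_next G (toggle e T).
set pos := findex next (e, false).
have [_ nJ] := n_boundary_quasi_tree_toggle e qT.
have iter_pos h : iter (pos h) next (e, false) = h.
  by apply: iter_findex; exact: quasi_tree_fconnect.
have next'E h : next' h = next (if h.1 == e then flip h else h).
  exact: boundary_next_toggle.
have next'_id h : h.1 != e -> next' h = next h by rewrite next'E => /negPf->.
(* Strictly between the ends of the chord of e the old and the new boundary
   permutations coincide. *)
have not_end i : 0 < i < fingraph.order next (e, false) -> i != pos (e, true) ->
    (iter i next (e, false)).1 != e.
  move=> /andP[i_gt0 lt_i] ne_i; apply/negP=> /eqP.
  have := findex_iter lt_i; case: (iter _ _ _) => a b + /= ea; rewrite {a}ea.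
  case: b => posE; first by rewrite -posE eqxx in ne_i.
  by rewrite -posE findex0 in i_gt0.
have m_lt : pos (e, true) < fingraph.order next (e, false).
  by apply: findex_max; exact: quasi_tree_fconnect.
(* The boundary component of (e, true) after the toggle is the arc from just
   after (e, false) up to (e, true); that of (e, false) is the rest. *)
have arc1 i : 0 < i <= pos (e, true) ->
    fconnect next' (e, true) (iter i next (e, false)).
  elim: i => // i IHi /andP[_ le_i]; case: (posnP i) => [->|i_gt0].
    suff <- : next' (e, true) = iter 1 next (e, false) by exact: fconnect1.
    by rewrite next'E /= eqxx.
  apply: connect_trans (IHi _) _; first by rewrite i_gt0 ltnW.
  rewrite iterS -next'_id; first exact: fconnect1.
  by apply: not_end; lia.
have arc0 i : pos (e, true) < i < fingraph.order next (e, false) ->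
    fconnect next' (e, false) (iter i next (e, false)).
  elim: i => // i IHi /andP[lt_i lti].
  have [lt_i'|le_i] := ltnP (pos (e, true)) i; last first.
    have -> : i = pos (e, true) by lia.
    rewrite iterS iter_pos.
    suff <- : next' (e, false) = next (e, true) by exact: fconnect1.
    by rewrite next'E /= eqxx.
  apply: connect_trans (IHi _) _; first by rewrite lt_i' ltnW.
  rewrite iterS -next'_id; first exact: fconnect1.
  by apply: not_end; lia.
have side h : h.1 != e -> fconnect next' (e, pos h < pos (e, true)) h.
  move=> ne_h; have pos_gt0 : 0 < pos h.
    by rewrite lt0n findex_eq0; apply: contraNneq ne_h => <-.
  rewrite -{2}(iter_pos h); case: ltngtP => [lt_h|gt_h|eq_pos].
  - by apply: arc1; rewrite pos_gt0 ltnW.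
  - by apply: arc0; rewrite gt_h findex_max //; exact: quasi_tree_fconnect.
  by rewrite -(iter_pos h) eq_pos iter_pos eqxx in ne_h.
have := side (e', false) ne_e'; have := side (e', true) ne_e'.
have sym' := @boundary_sym (toggle e T).
case: (pos (e', false) < _); case: (pos (e', true) < _) => st sf; rewrite /joined.
- by rewrite (connect_trans _ st) // sym'.
- apply/esym/negP=> J; case/negP: nJ; apply: (connect_trans st).
  by rewrite sym'; apply: (connect_trans sf).
- apply/esym/negP=> J; case/negP: nJ; apply: (connect_trans sf).
  by apply: (connect_trans J); rewrite sym'.
by rewrite (connect_trans _ st) // sym'.
Qed.

(** After toggling [e] there are two components.  A crossing chord joins them by
    a single further toggle; if no chord of an edge in [L] crosses, then no
    sequence of toggles in [L] ever joins them. *)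
Lemma active_extendable L T e : quasi_tree G T -> e \notin L ->
  [forall e' in L, ~~ chords_cross G T e e'] = ~~ extendable L (toggle e T).
Proof.
move=> qT Le; have [b2 _] := n_boundary_quasi_tree_toggle e qT.
have crossE f : f \in L -> chords_cross G T e f = ~~ joined (toggle e T) f.
  by move=> Lf; apply: chords_crossE => //; apply: contraNneq Le => <-.
apply/idP/idP=> [/forall_inP nocross|nex].
  apply/negP=> /all_joined_quasi_tree; rewrite /quasi_tree b2 => J; apply/notF/J => f Lf.
  by have := nocross f Lf; rewrite crossE // negbK.
apply/forall_inP=> f Lf; apply: contra nex; rewrite crossE // => nJ.
apply/extendableP; exists (toggle f (toggle e T)); first exact: agree_toggle_in.
have := n_boundary_toggle (toggle e T) f; rewrite nJ b2 /quasi_tree /=; lia.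
Qed.

(** * The quasi-tree expansion *)

Section Expansion.

Local Open Scope ring_scope.

Variables (lab : E -> 'I_#|E|) (R : comUnitRingType) (q : R).
Hypotheses (lab_bij : bijective lab) (q_unit : q \is a GRing.unit).

(** The edges that are still undecided when the edge labelled [k - 1] comes up. *)
Definition below (k : nat) : {set E} := [set e | (lab e < k)%N].

Definition edge_weight F e : R := if e \in F then - q else 1.

(** The correction that a forced edge makes to its plain weight; the product of
    the two weights is - q^2 or q^-1. *)
Definition activity_weight T e : R :=
  if active G lab T e then (if e \in T then - q ^- 2 else - q ^+ 2) else 1.

Definition state_sum L F : R :=
  \sum_(F' : {set E} | agree L F F')
    (\prod_(e in L) edge_weight F' e) * (q + q^-1) ^+ (n_boundary G F').-1.

Definition quasi_tree_sum L F : R :=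
  \sum_(T : {set E} | agree L F T && quasi_tree G T)
    \prod_(e in L) (edge_weight T e * activity_weight T e).

Lemma edge_weight_toggle F e :
  edge_weight (toggle e F) e = if e \in F then 1 else - q.
Proof. by rewrite /edge_weight toggle_id; case: (e \in F). Qed.

Lemma edge_weight_agree L F F' e : e \notin L -> agree L F F' ->
  edge_weight F' e = edge_weight F e.
Proof. by move=> Le /agreeP aF; rewrite /edge_weight aF. Qed.

Lemma sum_agreeU1 L F e (P : pred {set E}) (f : {set E} -> R) : e \notin L ->
  \sum_(F' | agree (e |: L) F F' && P F') f F' =
  \sum_(F' | agree L F F' && P F') f F' +
  \sum_(F' | agree L (toggle e F) F' && P F') f F'.
Proof.
move=> Le; rewrite (bigID (agree L F)) /=; congr (_ + _); apply: eq_bigl => F'.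
  rewrite agreeU1 //; case aF: (agree L F F'); last by rewrite !andbF.
  by rewrite (agree_disjoint Le aF) /= andbT.
rewrite agreeU1 //; case aF: (agree L F F'); last by rewrite andbT.
by rewrite (agree_disjoint Le aF) /= andbF.
Qed.

Lemma state_sumU1 L F e : e \notin L ->
  state_sum (e |: L) F = edge_weight F e * state_sum L F +
    edge_weight (toggle e F) e * state_sum L (toggle e F).
Proof.
move=> Le; have := sum_agreeU1 F xpredT (fun F' =>
  (\prod_(f in e |: L) edge_weight F' f) * (q + q^-1) ^+ (n_boundary G F').-1) Le.
under eq_bigl do rewrite andbT; under [X in _ = X + _]eq_bigl do rewrite andbT.
under [X in _ = _ + X]eq_bigl do rewrite andbT.
rewrite /state_sum => ->; rewrite !mulr_sumr.
by congr (_ + _); apply: eq_bigr => F' aF'; rewrite big_setU1 //= mulrA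
  (edge_weight_agree Le aF').
Qed.

(** With one more boundary component in every term, toggling [e] costs exactly
    one factor, the value of a circle. *)
Lemma state_sum_toggle L F e : e \notin L ->
    (forall F', agree L F F' -> joined F' e) ->
  state_sum L (toggle e F) = (q + q^-1) * state_sum L F.
Proof.
move=> Le JF; rewrite /state_sum (reindex_inj (inv_inj (toggleK e))) mulr_sumr /=.
apply: eq_big => F'; rewrite agree_toggle // => aF'.
rewrite mulrCA -exprS; congr (_ * _ ^+ _).
  apply: eq_bigr => f Lf; rewrite /edge_weight inE.
  by have /negPf-> : f != e; [apply: contraNneq Le => <- | rewrite addbF].
have := n_boundary_toggle F' e; rewrite JF //= addn0 => ->.
by rewrite prednK // n_boundary_gt0.
Qed.

Lemma quasi_tree_sum0 L F : ~~ extendable L F -> quasi_tree_sum L F = 0.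
Proof.
move=> nex; apply: big_pred0 => T; apply: contraNF nex => /andP[aT qT].
by apply/extendableP; exists T.
Qed.

Lemma active_below T e : quasi_tree G T ->
  active G lab T e = ~~ extendable (below (lab e)) (toggle e T).
Proof.
move=> qT; rewrite -active_extendable // ?inE ?ltnn //; apply: eq_forallb => e'.
by rewrite inE.
Qed.

(** Whether [e] is active in [T] depends only on the decisions on the edges from
    [e] on, hence is constant on each of the two halves of the sum. *)
Lemma quasi_tree_sumU1 F e (w := fun A => if extendable (below (lab e)) (toggle e A)
    then 1 else if e \in A then - q ^- 2 else - q ^+ 2) :
  quasi_tree_sum (e |: below (lab e)) F =
    edge_weight F e * w F * quasi_tree_sum (below (lab e)) F +
    edge_weight (toggle e F) e * w (toggle e F) *
      quasi_tree_sum (below (lab e)) (toggle e F).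
Proof.
have Le : e \notin below (lab e) by rewrite inE ltnn.
rewrite /quasi_tree_sum sum_agreeU1 // !mulr_sumr.
have wE A T : agree (below (lab e)) A T -> quasi_tree G T ->
    edge_weight T e * activity_weight T e = edge_weight A e * w A.
  move=> aT qT; rewrite (edge_weight_agree Le aT) /activity_weight active_below //.
  rewrite (agreeP _ _ _ aT e Le) /w.
  rewrite (@eq_extendable _ (toggle e A) (toggle e T)); last by rewrite agree_toggle.
  by case: extendable.
by congr (_ + _); apply: eq_bigr => T /andP[aT qT];
  rewrite big_setU1 //= (wE _ _ aT qT).
Qed.

Lemma state_sum_agree L F F' : agree L F F' -> state_sum L F = state_sum L F'.
Proof. by move=> /agree_eql eqF; apply: eq_bigl. Qed.

Lemma quasi_tree_sum_agree L F F' :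
  agree L F F' -> quasi_tree_sum L F = quasi_tree_sum L F'.
Proof. by move=> /agree_eql eqF; apply: eq_bigl => T; rewrite eqF. Qed.

Lemma quasi_tree_expansion_below k F : (k <= #|E|)%N ->
  extendable (below k) F -> state_sum (below k) F = quasi_tree_sum (below k) F.
Proof.
have [lab' labK lab'K] := lab_bij.
elim: k F => [|k IHk] F le_k extF.
  have below0 : below 0 = set0 by apply/setP=> e; rewrite !inE.
  move: extF; rewrite /state_sum /quasi_tree_sum below0.
  have agree0 F' : agree set0 F F' = (F' == F) by rewrite /agree !setD0.
  case/extendableP=> T; rewrite agree0 => /eqP-> qF.
  rewrite (big_pred1 F) // (big_pred1 F) => [|F']; last first.
    by rewrite agree0 /=; case: eqP => [->|] //.
  by rewrite !big_set0 (eqP qF) mulr1.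
pose e := lab' (Ordinal le_k).
have lab_e : lab e = k :> nat by rewrite /e lab'K.
have belowS : below k.+1 = e |: below (lab e).
  apply/setP=> f; rewrite !inE lab_e ltnS leq_eqVlt -lab_e; congr (_ || _).
  by rewrite (inj_eq val_inj) (inj_eq (can_inj labK)).
have Le : e \notin below (lab e) by rewrite inE ltnn.
rewrite belowS in extF *; rewrite -lab_e in IHk.
have {}IHk A := IHk A (ltnW (ltn_ord _)).
(* At least one choice for e extends; toggling e exchanges the two. *)
wlog extF' : F extF / extendable (below (lab e)) F.
  move=> thm; have [/thm->//|nexF] := boolP (extendable (below (lab e)) F).
  have aF : agree (e |: below (lab e)) F (toggle e F) by rewrite agree_toggle_in ?inE ?eqxx.
  rewrite (state_sum_agree aF) (quasi_tree_sum_agree aF); apply: thm.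
    by rewrite -(eq_extendable aF).
  have [T aT qT] := extendableP _ _ extF; apply/extendableP; exists T => //.
  have nFT : ~~ agree (below (lab e)) F T.
    by apply: contra nexF => aFT; apply/extendableP; exists T.
  by move: aT; rewrite agreeU1 // (negPf nFT).
rewrite state_sumU1 // quasi_tree_sumU1 /= toggleK extF' (IHk F) //.
have [exT|nexT] := boolP (extendable (below (lab e)) (toggle e F)).
  by rewrite !mulr1 (IHk (toggle e F)).
rewrite (quasi_tree_sum0 nexT) mulr0 addr0 state_sum_toggle //; last first.
  by apply: joined_of_forced nexT.
rewrite mulrA (IHk F) // -mulrDl edge_weight_toggle /edge_weight; congr (_ * _).
case: (e \in F).
  by rewrite mul1r addKr mulrNN expr2 invrM // mulrA mulrV // mul1r.
by rewrite !mul1r mulNr mulrDr mulrV // opprD addrCA subrr addr0.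
Qed.

(** Before any decision every edge set is reachable, and connectedness makes the
    empty set of decisions extend to a quasi-tree. *)
Theorem quasi_tree_expansion : ribbon_connected ->
  \sum_(F : {set E}) (- q) ^+ #|F| * (q + q^-1) ^+ (n_boundary G F).-1 =
  \sum_(T : {set E} | quasi_tree G T)
    (- q) ^+ #|T| * (- q ^+ 2) ^+ ext_activity G lab T *
    (- q ^- 2) ^+ int_activity G lab T.
Proof.
move=> connG; have belowT : below #|E| = setT.
  by apply/setP=> e; rewrite !inE ltn_ord.
have := @quasi_tree_expansion_below #|E| set0 (leqnn _).
rewrite belowT => /(_ (connected_extendable _ connG)).
have agreeT F : agree setT set0 F by apply/agreeP=> e; rewrite inE.
have edgeT F : \prod_(e in [set: E]) edge_weight F e = (- q) ^+ #|F|.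
  rewrite -prodr_const [RHS]big_mkcond.
  by apply: eq_bigl => e; rewrite inE.
have actT T : \prod_(e in [set: E]) activity_weight T e =
    (- q ^+ 2) ^+ ext_activity G lab T * (- q ^- 2) ^+ int_activity G lab T.
  rewrite -!prodr_const [X in _ = X * _]big_mkcond [X in _ = _ * X]big_mkcond.
  rewrite -big_split /=; apply: eq_big => e; rewrite ?inE // => _.
  by rewrite /activity_weight; case: active; case: (e \in T); rewrite ?mulr1 ?mul1r.
rewrite /state_sum /quasi_tree_sum.
under eq_bigl do rewrite agreeT; under eq_bigr do rewrite edgeT; move->.
apply: eq_big => [T|T _]; first by rewrite agreeT.
by rewrite big_split /= edgeT actT mulrA.
Qed.

End Expansion.

End Ribbon.
(** * From states to spanning ribbon subgraphs *)

Section Diagram.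

Variables (D : link_diagram) (inward : crossing D * corner -> bool).
Hypothesis inward_disk : disk_orientation inward.
Implicit Types (x : crossing D) (u v : crossing D * corner) (h : crossing D * bool).
Implicit Types (S : {set crossing D}).

Definition arrow_of u : crossing D * bool := (u.1, arrow_at u.2).

(** The end at which the oriented circle reaches the arrow [h]; the arrows are in
    bijection with the ends at which circles run into a crossing. *)
Definition arrow_entry h : crossing D * corner :=
  (h.1, if inward (h.1, arrow_tail h.2) then arrow_tail h.2 else arrow_head h.2).

(** The end of the arc of [u] to which the orientation leads: each arc has
    exactly one inward end, which represents it. *)
Definition ahead u := if inward u then u else Defs.arc u.

Lemma inward_arc u : inward (Defs.arc u) = ~~ inward u.
Proof. by case: inward_disk. Qed.

Lemma inward_corner x k :
  inward (x, k) = inward (x, SW) (+) (if k is (SE | NW) then true else false).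
Proof.
have [_ inA inE] := inward_disk; have := inE x; rewrite /arrow_tail => eqE.
case: k; rewrite ?addbT ?addbF //; first by rewrite (inA x NE) -eqE.
by rewrite (inA x SW).
Qed.

Lemma inward_ahead u : inward (ahead u).
Proof. by rewrite /ahead; case: ifP => // nu; rewrite inward_arc nu. Qed.

Lemma inward_entry h : inward (arrow_entry h).
Proof.
case: h => x b; rewrite /arrow_entry inward_corner (inward_corner _ (arrow_tail _)).
by case: b; case: (inward (x, SW)).
Qed.

Lemma arrow_of_entry h : arrow_of (arrow_entry h) = h.
Proof. by case: h => x b; rewrite /arrow_of /arrow_entry /=; case: ifP; case: b. Qed.

Lemma entry_arrow_of u : inward u -> arrow_entry (arrow_of u) = u.
Proof.
case: u => x k; rewrite /arrow_entry /arrow_of /= !(inward_corner _ (arrow_tail _)).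
by rewrite (inward_corner _ k); case: k; case: (inward (x, SW)).
Qed.

(** The disk orientations alternate around each crossing, so that not only the
    A-arcs but also the B-arcs are consistently oriented by them. *)
Lemma inward_smoothing S u : inward (smoothing S u) = ~~ inward u.
Proof.
case: u => x k; rewrite /smoothing /= inward_corner (inward_corner _ k).
by case: ifP => _; case: k; case: (inward (x, SW)).
Qed.

Lemma smoothingK S : involutive (smoothing S).
Proof.
by case=> x k; rewrite /smoothing /=; case: (x \in S); case: k.
Qed.

(** A B-arc leads from one arrow to the exit of the other: it is the free side
    of the band that joins them. *)
Lemma smoothing_entry S h :
  smoothing S (arrow_entry h) =
  arrow_exit inward (if h.1 \in S then flip h else h).
Proof.
case: h => x b; rewrite /smoothing /arrow_entry /arrow_exit /flip /=.
case: (x \in S); rewrite /= !(inward_corner _ (arrow_tail _));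
  by case: b; case: (inward (x, SW)).
Qed.

(** Representing each arc of the diagram by its inward end, i.e. by the arrow
    there, turns relations on ends into relations on arrows. *)
Lemma n_comp_ends (e : rel (crossing D * corner)) (e' : rel (crossing D * bool)) :
    connect_sym e -> connect_sym e' ->
    (forall u, e u (Defs.arc u)) ->
    (forall h h', e' h h' -> connect e (arrow_entry h) (arrow_entry h')) ->
    (forall u v, e u v -> connect e' (arrow_of (ahead u)) (arrow_of (ahead v))) ->
  n_comp e predT = n_comp e' predT.
Proof.
move=> sym_e sym_e' e_arc e'e ee'.
have clT : closed e predT by [].
rewrite (adjunction_n_comp arrow_entry sym_e sym_e' clT); first exact: eq_n_comp_r.
apply: (intro_adjunction sym_e' clT (fun u _ => arrow_of (ahead u))).
  move=> u _; split=> [|v _]; last exact: ee'.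
  rewrite entry_arrow_of ?inward_ahead // /ahead.
  by case: ifP => _; [exact: connect0 | exact: connect1].
move=> h _; split=> [|h']; last exact: e'e.
by rewrite /ahead inward_entry arrow_of_entry connect0.
Qed.

Variable G : ribbon_graph (crossing D).
Hypotheses (isolatedG : isolated G = loops D).
Hypothesis vrotG : forall h, vrot G h = next_arrow inward h.

Lemma boundary_next_arrow S h :
  boundary_next G S h = arrow_of (Defs.arc (smoothing S (arrow_entry h))).
Proof. by rewrite /boundary_next vrotG smoothing_entry. Qed.

Lemma entry_boundary_next S h :
  arrow_entry (boundary_next G S h) = Defs.arc (smoothing S (arrow_entry h)).
Proof.
rewrite boundary_next_arrow entry_arrow_of //.
by rewrite inward_arc inward_smoothing inward_entry.
Qed.

(** One step along the boundary of the subgraph is a resolution arc at a crossing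
    followed by an arc of the diagram. *)
Lemma state_circles_boundary S : state_circles S = n_boundary G S.
Proof.
rewrite /state_circles /n_boundary isolatedG; congr (_ + _).
set e := [rel u v | _]; have sym_e : symmetric e.
  by move=> u v /=; congr (_ || _); rewrite eq_sym inv_eq //;
    [exact: arcK | exact: smoothingK].
have {sym_e} sym_ce := sym_connect_sym sym_e.
apply: n_comp_ends => //; first exact: boundary_sym.
- by move=> u; rewrite /= eqxx.
- move=> h _ /eqP <-; rewrite entry_boundary_next.
  by apply: (@connect_trans _ _ (smoothing S (arrow_entry h)));
    apply: connect1; rewrite /= eqxx ?orbT.
have step u : inward u ->
    fconnect (boundary_next G S) (arrow_of u) (arrow_of (ahead (smoothing S u))).
  move=> in_u; rewrite /ahead inward_smoothing in_u /=.
  rewrite -{2}(entry_arrow_of in_u) -boundary_next_arrow; exact: fconnect1.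
move=> u v /orP[/eqP->|/eqP->].
  by rewrite /ahead inward_arc arcK; case: (inward u); exact: connect0.
have [in_u|out_u] := boolP (inward u); first by rewrite [ahead u]/ahead in_u; exact: step.
rewrite boundary_sym [ahead (smoothing _ _)]/ahead inward_smoothing out_u.
by rewrite -{2}[u](smoothingK S); apply: step; rewrite inward_smoothing.
Qed.

(** Vertices of the ribbon graph are circles made of arcs of the diagram, and
    its edges are the crossings; so both have the same components. *)
Lemma connected_diagram_ribbon : connected_diagram D -> ribbon_connected G.
Proof.
rewrite /connected_diagram /ribbon_connected isolatedG => <-; congr (_ + _).
apply/esym; rewrite /map_components; set e := [rel u v | _].
apply: n_comp_ends; last 3 first.
- by move=> u; rewrite /= eqxx.
- move=> h h' /= /orP[/eqP->|/eqP eq_x]; last by apply: connect1; rewrite /= eq_x eqxx orbT.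
  have -> : vrot G h = boundary_next G set0 h by rewrite /boundary_next in_set0.
  rewrite entry_boundary_next.
  by apply: (@connect_trans _ _ (smoothing set0 (arrow_entry h)));
    apply: connect1; rewrite /= eqxx ?orbT.
- set e' := [rel h h' | _].
  have step u b : connect e' (arrow_of (ahead u)) (u.1, b).
    rewrite /ahead; case: ifP => [_|out_u]; first by apply: connect1; rewrite /= eqxx orbT.
    rewrite ribbon_sym; pose h := arrow_of (smoothing set0 u).
    apply: (@connect_trans _ _ h); first by apply: connect1; rewrite /= eqxx orbT.
    apply: connect1; rewrite /= orbC; apply/orP; right.
    have -> : vrot G h = boundary_next G set0 h by rewrite /boundary_next in_set0.
    rewrite boundary_next_arrow entry_arrow_of ?smoothingK //.
    by rewrite inward_smoothing out_u.
  move=> u v /= /orP[/eqP->|/eqP eq_x].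
    by rewrite /ahead inward_arc arcK; case: (inward u); exact: connect0.
  apply: connect_trans (step u true) _; rewrite eq_x ribbon_sym; exact: step.
- apply: sym_connect_sym => u v /=.
  congr (_ || _); last exact: eq_sym.
  by rewrite eq_sym inv_eq //; exact: arcK.
- exact: ribbon_sym.
Qed.

End Diagram.

(** * The Jones polynomial *)

Local Open Scope ring_scope.

(* t^(1/2) = - q *)
Theorem corollary7p10 (D : link_diagram) (hD : connected_diagram D)
    (DD : ribbon_graph (crossing D)) (hDD : all_A_ribbon_graph DD)
    (lab : crossing D -> 'I_#|crossing D|) (hlab : bijective lab)
    (R : comUnitRingType) (q : R) (hq : q \is a GRing.unit) :
  jones D (- q) =
  \sum_(T : {set crossing D} | quasi_tree DD T)
    (- 1) ^ (i_grading DD lab T - (n_minus D)%:Z)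
    * q ^ (j_grading DD lab T + (n_plus D)%:Z - 2 * (n_minus D)%:Z).
Proof.
have [iso [inward inP rotP]] := hDD.
have connDD := connected_diagram_ribbon inP iso rotP hD.
have uN1 : (- 1 : R) \is a GRing.unit by rewrite unitrN1.
(* All factors are monomials in -1 and q, whose exponents can be compared. *)
pose mon (a b : int) : R := (- 1) ^ a * q ^ b.
have monM a b c d : mon a b * mon c d = mon (a + c) (b + d).
  by rewrite /mon mulrACA -!exprzDr.
have monX a b n : mon a b ^+ n = mon (a * n%:Z) (b * n%:Z).
  by rewrite /mon exprMn !exprnP !exprz_exp.
have monNq (z : int) : (- q) ^ z = mon z z.
  by rewrite -mulN1r exprMz_comm //; apply/commr_sym/commrN1.
have monNq2 : - q ^+ 2 = mon 1 2 by rewrite /mon mulN1r.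
have monNqV2 : - q ^- 2 = mon 1 (- 2) by rewrite /mon mulN1r exprnN.
have mon_sign (a b c d : int) : a = b + 2 * c -> mon a d = mon b d.
  by move=> ->; rewrite /mon exprzDr // -exprz_exp -[(- 1) ^ 2]exprnP sqrrN expr1n exp1rz mulr1.
have uNq : - q \is a GRing.unit by rewrite unitrN.
pose C := (- 1) ^ writhe D * (- q) ^ ((n_plus D)%:Z - 2 * (n_minus D)%:Z).
transitivity (C * \sum_(S : {set crossing D})
    (- q) ^+ #|S| * (q + q^-1) ^+ (n_boundary DD S).-1).
  rewrite /jones /C -mulrA; congr (_ * _); rewrite mulr_sumr.
  apply: eq_bigr => S _; rewrite exprzDr // (state_circles_boundary inP iso rotP).
  by rewrite invrN !opprK !mulrA.
rewrite (quasi_tree_expansion hlab hq connDD) mulr_sumr; apply: eq_bigr => T qT.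
have := genus_quasi_tree qT; rewrite /C /i_grading /j_grading => genusT.
have -> : (- 1) ^ writhe D = mon (writhe D) 0 by rewrite /mon expr0z mulr1.
rewrite [(- q) ^+ _]exprnP !monNq monNq2 monNqV2 !monX !monM /writhe.
rewrite -[RHS]/(mon _ _).
(* The signs agree because the exponents differ by 2 (n_+ - n_- + ia(T)). *)
rewrite (mon_sign _ (2 * (genus DD T)%:Z + (ext_activity DD lab T)%:Z -
  (int_activity DD lab T)%:Z + (n_vertices DD)%:Z - 1 - (n_minus D)%:Z)
  ((n_plus D)%:Z - (n_minus D)%:Z + (int_activity DD lab T)%:Z)); last by lia.
by congr (mon _ _); lia.
Qed.
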